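(* Let $N\ge 3$ and $K\ge1$ be integers, let $\rho_{u1},\rho_{u2},\rho_e>0$, $Q_1,Q_2>0$, $\beta_1,\beta_2\in[0,1]$ be real numbers, and set $$c_1=(1+(N-1)\beta_1)\rho_{u1},\quad c_2=(1+(N-1)\beta_2)\rho_{u2},\quad \gamma_1=\frac{1}{c_2}(2^{Q_2}-1),\quad \gamma_0=\frac{1}{c_1}(2^{Q_1}-1)(1+\gamma_1\rho_{u1}).$$ Consider the (high-SNR) optimization problem $\mathbf{P6}$: $$\max_{\phi_1,\phi_2}\;\Big[\log_2\big(\phi_1(1+(1-\phi_1-\phi_2)\rho_e)^K\big)+\log_2\big(((N-1)\beta_1+1)c_2\big)-K\log_2(1+\rho_e)\Big]$$ subject to $$\phi_1\ge\frac{1}{c_1}(2^{Q_1}-1)(1+\phi_2\rho_{u1}),\qquad \phi_2\ge\frac{1}{c_2}(2^{Q_2}-1),\qquad \phi_e:=1-\phi_1-\phi_2\ge0,$$ and assume it is feasible. Then the optimal power allocation coefficients, i.e. the solution of $\mathbf{P6}$, are $$\phi_1^{\ast}=\begin{cases}\dfrac{1+\rho_e-\gamma_1\rho_e}{(K+1)\rho_e}, & \text{when } \gamma_0\le\dfrac{1+\rho_e-\gamma_1\rho_e}{(K+1)\rho_e}\le 1-\gamma_1,\\[2mm] 1-\gamma_1, & \text{when } \dfrac{1+\rho_e-\gamma_1\rho_e}{(K+1)\rho_e}>1-\gamma_1,\\[2mm] \gamma_0, & \text{when } \dfrac{1+\rho_e-\gamma_1\rho_e}{(K+1)\rho_e}<\gamma_0,\end{cases}$$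 $$\phi_2^{\ast}=\gamma_1,\qquad \phi_e^{\ast}=1-\phi_1^{\ast}-\phi_2^{\ast}.$$
   Context: $\mathbf{P6}$ is the problem obtained from a secrecy-sum-rate maximization when the objective is replaced by its approximation in the high-SNR regime $\rho_{u1}\to\infty$, $\rho_{u2}\to\infty$ (for fixed beamforming parameters $\beta_1,\beta_2$); the theorem gives the exact solution of $\mathbf{P6}$. Here $N$ and $K$ are the numbers of antennas at the transmitter and the eavesdropper, $\rho_{u1},\rho_{u2},\rho_e$ are the average SNRs of the two users and the eavesdropper, $\phi_1,\phi_2,\phi_e$ are power fractions for user 1, user 2 and artificial noise, and $Q_1,Q_2$ are the minimum rates required by the users. *)

(* Defs.v *)
From Stdlib Require Import Reals.
Open Scope R_scope.

Definition P6_objective (N K : nat) (rho_e beta1 c2 phi1 phi2 : R) : R :=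
  Rlog 2 (phi1 * (1 + (1 - phi1 - phi2) * rho_e) ^ K)
  + Rlog 2 (((INR N - 1) * beta1 + 1) * c2)
  - INR K * Rlog 2 (1 + rho_e).

(* [Rlog] is total (the logarithm of a nonpositive number is 0), but when
   [c1], [c2], [rho_u1], [rho_e], [Q1], [Q2] are positive these constraints
   force [0 < phi1], so the logarithm containing [phi1] and [phi2] is the
   genuine one. *)
Definition P6_feasible (c1 c2 rho_u1 Q1 Q2 phi1 phi2 : R) : Prop :=
  phi1 >= 1 / c1 * (Rpower 2 Q1 - 1) * (1 + phi2 * rho_u1) /\
  phi2 >= 1 / c2 * (Rpower 2 Q2 - 1) /\
  1 - phi1 - phi2 >= 0.

Definition is_maximizer (feasible : R -> R -> Prop) (objective : R -> R -> R)
    (phi1 phi2 : R) : Prop :=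
  feasible phi1 phi2 /\
  forall psi1 psi2 : R,
    feasible psi1 psi2 -> objective psi1 psi2 <= objective phi1 phi2.

(* Main.v *)
(** At fixed [phi1] the objective decreases in [phi2], which pushes [phi2] down
    to [gamma1].  On that line the logarithm of the objective is concave with
    stationary point [x], so the optimum is the projection of [x] onto
    [[gamma0, 1 - gamma1]].  Both effects come from one tangent-line estimate,
    [ln t <= t - 1], applied to the ratios of the two factors to their values
    at the projection, combined with the variational inequality
    [(p - p0) * (x - p0) <= 0] of the projection [p0]. *)

Require Import Defs.
From Stdlib Require Import Reals Lra.
Open Scope R_scope.

(** This is [1 + y < exp y] for nonzero [y], taken at [y = ln (t / a)]. Its strictness is what makes
    the maximizer unique. *)
Lemma ln_lt_tangent (a t : R) :
  0 < a -> 0 < t -> t <> a -> ln t < ln a + (t - a) / a.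
Proof.
intros ha ht hne.
assert (hdiv : ln (t / a) = ln t - ln a).
{ unfold Rdiv; rewrite ln_mult, ln_Rinv;
    [ring | assumption | assumption | now apply Rinv_0_lt_compat]. }
assert (hne' : ln (t / a) <> 0).
{ rewrite hdiv; intro H; apply hne, ln_inv; lra. }
assert (H := exp_ineq1 _ hne').
rewrite exp_ln in H by now apply Rdiv_lt_0_compat.
replace ((t - a) / a) with (t / a - 1) by (field; lra).
lra.
Qed.

Lemma ln_le_tangent (a t : R) : 0 < a -> 0 < t -> ln t <= ln a + (t - a) / a.
Proof.
intros ha ht.
destruct (Req_dec t a) as [-> | hne].
- unfold Rdiv; rewrite Rminus_diag; lra.
- now apply Rlt_le, ln_lt_tangent.
Qed.

Lemma Rpower_gt_1 (a r : R) : 1 < a -> 0 < r -> 1 < Rpower a r.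
Proof.
intros ha hr.
rewrite <- (Rpower_O a) by lra.
apply Rpower_lt; lra.
Qed.

(** If [x] lies in the interval, the second factor vanishes. Otherwise the clamp is the endpoint
    nearest to [x], and [p] and [x] lie on opposite sides of it. *)
Lemma clamp_variational (lo hi x p : R) :
  lo <= p <= hi ->
  (p - Rmax lo (Rmin x hi)) * (x - Rmax lo (Rmin x hi)) <= 0.
Proof.
intros hp.
unfold Rmax, Rmin.
destruct (Rle_dec x hi); destruct (Rle_dec lo _); nra.
Qed.

(** At [(p0, g)] the derivative in [p] of the logarithm is [1 / p0 - INR K * r / s0], with [s0] the
    base of the power there. Since [s0 = (INR K + 1) * r * x - r * p0], it is a positive multiple of
    [x - p0]. *)
Lemma objective_lt_of_variational (K : nat) (r g x p0 p q : R) :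
  (1 <= K)%nat -> 0 < r -> 0 < p0 -> p0 <= 1 - g ->
  0 < p -> p + q <= 1 -> g <= q ->
  x = (1 + r - g * r) / ((INR K + 1) * r) ->
  (p - p0) * (x - p0) <= 0 ->
  p <> p0 \/ q <> g ->
  ln (p * (1 + (1 - p - q) * r) ^ K) < ln (p0 * (1 + (1 - p0 - g) * r) ^ K).
Proof.
intros hK hr hp0 hp0g hp hpq hq hx hvar hne.
assert (hKR : 1 <= INR K) by (apply (le_INR 1); exact hK).
set (s := 1 + (1 - p - q) * r).
set (s0 := 1 + (1 - p0 - g) * r).
assert (hs : 0 < s) by (unfold s; nra).
assert (hs0 : 0 < s0) by (unfold s0; nra).
rewrite !ln_mult, !ln_pow by (assumption || now apply pow_lt).
assert (hls := ln_le_tangent s0 s hs0 hs).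
assert (hKs : INR K * ln s <= INR K * (ln s0 + (s - s0) / s0))
  by (apply Rmult_le_compat_l; lra).
(* The first-order term splits into the variational part and the loss from
   [q > g]. *)
assert (heq : (p - p0) / p0 + INR K * ((s - s0) / s0) =
  (INR K + 1) * r / (p0 * s0) * ((p - p0) * (x - p0))
  - INR K * r / s0 * (q - g)).
{ rewrite hx; unfold s, s0 in *; field; repeat split; lra. }
assert (hc1 : 0 < (INR K + 1) * r / (p0 * s0))
  by (apply Rdiv_lt_0_compat; nra).
assert (hc2 : 0 < INR K * r / s0) by (apply Rdiv_lt_0_compat; nra).
(* Strictness comes from the loss term when [p = p0], and from the strict tangent bound
   otherwise. *)
destruct (Req_dec p p0) as [e | hpne].
- assert (hqg : g < q) by (destruct hne; lra).
  assert (hlp := ln_le_tangent p0 p hp0 hp).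
  nra.
- assert (hlp := ln_lt_tangent p0 p hp0 hp hpne).
  nra.
Qed.

Theorem theorem2 (N K : nat) (rho_u1 rho_u2 rho_e Q1 Q2 beta1 beta2 : R)
  (hN : (3 <= N)%nat) (hK : (1 <= K)%nat)
  (hrho_u1 : 0 < rho_u1) (hrho_u2 : 0 < rho_u2) (hrho_e : 0 < rho_e)
  (hQ1 : 0 < Q1) (hQ2 : 0 < Q2)
  (hbeta1 : 0 <= beta1 <= 1) (hbeta2 : 0 <= beta2 <= 1) :
  let c1 := (1 + (INR N - 1) * beta1) * rho_u1 in
  let c2 := (1 + (INR N - 1) * beta2) * rho_u2 in
  let gamma1 := 1 / c2 * (Rpower 2 Q2 - 1) in
  let gamma0 := 1 / c1 * (Rpower 2 Q1 - 1) * (1 + gamma1 * rho_u1) in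
  let feasible := P6_feasible c1 c2 rho_u1 Q1 Q2 in
  let objective := P6_objective N K rho_e beta1 c2 in
  let x := (1 + rho_e - gamma1 * rho_e) / ((INR K + 1) * rho_e) in
  (exists phi1 phi2 : R, feasible phi1 phi2) ->
  exists phi1_star phi2_star phi_e_star : R,
    (gamma0 <= x <= 1 - gamma1 -> phi1_star = x) /\
    (x > 1 - gamma1 -> phi1_star = 1 - gamma1) /\
    (x < gamma0 -> phi1_star = gamma0) /\
    phi2_star = gamma1 /\
    phi_e_star = 1 - phi1_star - phi2_star /\
    (forall phi1 phi2 : R,
       is_maximizer feasible objective phi1 phi2 <->
       phi1 = phi1_star /\ phi2 = phi2_star).
Proof.
intros c1 c2 gamma1 gamma0 feasible objective x [f1 [f2 hf]].
assert (hN1 : 0 <= INR N - 1).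
{ apply (le_INR 3) in hN; simpl in hN; lra. }
assert (hc1 : 0 < c1) by (unfold c1; apply Rmult_lt_0_compat; nra).
assert (hc2 : 0 < c2) by (unfold c2; apply Rmult_lt_0_compat; nra).
set (A := 1 / c1 * (Rpower 2 Q1 - 1)) in *.
assert (hA : 0 < A).
{ assert (H := Rpower_gt_1 2 Q1 ltac:(lra) hQ1).
  apply Rmult_lt_0_compat; [apply Rdiv_lt_0_compat |]; lra. }
assert (hg1 : 0 < gamma1).
{ assert (H := Rpower_gt_1 2 Q2 ltac:(lra) hQ2).
  apply Rmult_lt_0_compat; [apply Rdiv_lt_0_compat |]; lra. }
assert (hg0 : 0 < gamma0) by (unfold gamma0; apply Rmult_lt_0_compat; nra).
(* The lower bound on [p] increases with [q], so it is weakest at [q = gamma1], where it equals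
   [gamma0]. *)
assert (hbox : forall p q, feasible p q ->
  gamma0 <= p <= 1 - gamma1 /\ gamma1 <= q /\ p + q <= 1).
{ intros p q (h1 & h2 & h3).
  fold A in h1; fold gamma1 in h2.
  assert (gamma0 <= A * (1 + q * rho_u1)).
  { unfold gamma0; apply Rmult_le_compat_l; nra. }
  lra. }
(* Feasibility makes the interval nonempty, so the projection lands in it. *)
assert (hle : gamma0 <= 1 - gamma1) by (apply hbox in hf; lra).
set (p0 := Rmax gamma0 (Rmin x (1 - gamma1))).
assert (hp0 : gamma0 <= p0 <= 1 - gamma1).
{ split; [apply Rmax_l | apply Rmax_lub; [exact hle | apply Rmin_r]]. }
assert (hfeas0 : feasible p0 gamma1).
{ split; [| split].
  - fold A; fold gamma0; lra.
  - fold gamma1; lra.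
  - lra. }
assert (hlt : forall p q, feasible p q -> p <> p0 \/ q <> gamma1 ->
  objective p q < objective p0 gamma1).
{ intros p q hpq hne.
  destruct (hbox p q hpq) as (hp & hq & hsum).
  assert (H : ln (p * (1 + (1 - p - q) * rho_e) ^ K)
              < ln (p0 * (1 + (1 - p0 - gamma1) * rho_e) ^ K)).
  { apply objective_lt_of_variational with (x := x); try assumption; try lra.
    - reflexivity.
    - now apply clamp_variational. }
  (* This gives [0 < ln 2], so passing to base 2 preserves the strict inequality. *)
  assert (hln2 := ln_lt_2).
  unfold objective, P6_objective, Rlog.
  apply Rplus_lt_compat_r, Rplus_lt_compat_r.
  apply Rmult_lt_compat_r; [apply Rinv_0_lt_compat; lra | exact H]. }
exists p0, gamma1, (1 - p0 - gamma1).
split; [| split; [| split; [| split; [reflexivity | split; [reflexivity |]]]]].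
- intros hx; unfold p0; rewrite Rmin_left, Rmax_right; lra.
- intros hx; unfold p0; rewrite Rmin_right, Rmax_right; lra.
- intros hx; unfold p0; rewrite Rmin_left, Rmax_left; lra.
- intros p q; split.
  + intros [hpq hmax].
    assert (h := hmax _ _ hfeas0).
    destruct (Req_dec p p0) as [ep | np]; [destruct (Req_dec q gamma1) |].
    * now split.
    * assert (h' := hlt p q hpq ltac:(now right)); lra.
    * assert (h' := hlt p q hpq ltac:(now left)); lra.
  + intros [-> ->]; split; [exact hfeas0 |].
    intros r s hrs.
    destruct (Req_dec r p0) as [-> | nr]; [destruct (Req_dec s gamma1) as [-> | ns] |].
    * lra.
    * apply Rlt_le, hlt; [exact hrs | now right].
    * apply Rlt_le, hlt; [exact hrs | now left].
Qed.
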